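(* For each $k\ge1$ and $\lambda,\varepsilon\in(0,1]$ there exist constants $C=C_k\in\mathbb N$ (depending only on $k$) and $p_0=p_0(k,\lambda,\varepsilon)<1$ such that the following holds. Let $\Gamma$ be an Abelian group with generating set $S=\{x_1,\ldots,x_k\}$, and let $r\ge1$ be an integer with $|r\hat S|\ge\lambda(r+1)\log(r+1)$. Then, for Bernoulli-$p$ bond percolation on $\operatorname{Cay}(\Gamma,S)$, \[ \mathbb P_p\bigl(x\xleftrightarrow{\;C r\hat S\;}y\bigr)\ge1-\varepsilon \] for every $p\ge p_0$ and all $x,y\in r\hat S$.
   Context: Abelian groups are written additively. $\hat S=S\cup\{0\}\cup(-S)$, and for $A\subseteq\Gamma$ and a positive integer $m$, $mA=\{a_1+\cdots+a_m:a_i\in A\}$. $\operatorname{Cay}(\Gamma,S)$ has vertex set $\Gamma$ and an edge $\{x,y\}$ whenever $x-y\in (S\cup -S)\setminus\{0\}$. Bernoulli-$p$ bond percolation keeps each edge independently with probability $p$. For vertices $x,y$ and a vertex set $A$, $\{x\xleftrightarrow{A}y\}$ is the event that $x$ and $y$ are joined by an open path all of whose edges have both endpoints in $A$. *)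

(* Defs.v *)
From mathcomp Require Import all_boot all_order all_algebra.
From mathcomp Require Import boolp reals exp.
Set Implicit Arguments. Unset Strict Implicit. Unset Printing Implicit Defensive.
Import Order.TTheory GRing.Theory Num.Theory.
Local Open Scope ring_scope.

Definition hat (G : zmodType) (S : seq G) : seq G := S ++ 0 :: map -%R S.

Fixpoint sumset (G : zmodType) (A : seq G) (m : nat) : seq G :=
  match m with
  | 0 => [:: 0]
  | m'.+1 => undup [seq a + b | a <- A, b <- sumset A m']
  end.

Definition cay_adj (G : zmodType) (S : seq G) (x y : G) : bool :=
  (x - y != 0) && ((x - y \in S) || (y - x \in S)).

(* the (unordered) edges of Cay(G,S) with both endpoints in A, each listed
   once as a pair (x,y) with x before y in the list undup A *)
Definition edges_in (G : zmodType) (S : seq G) (A : seq G) : seq (G * G) :=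
  let V := undup A in
  [seq xy <- [seq (x, y) | x <- V, y <- V]
     | (index xy.1 V < index xy.2 V)%N && cay_adj S xy.1 xy.2].

Definition open_rel (G : zmodType) (E : seq (G * G))
  (w : {ffun 'I_(size E) -> bool}) : rel G :=
  fun x y => [exists i, w i &&
     ((nth (0, 0) E i == (x, y)) || (nth (0, 0) E i == (y, x)))].

Definition joined (G : zmodType) (E : seq (G * G))
  (w : {ffun 'I_(size E) -> bool}) (x y : G) : Prop :=
  exists s : seq G, path (open_rel w) x s /\ last x s = y.

Definition perc_prob (R : realType) (G : zmodType) (E : seq (G * G)) (p : R)
  (x y : G) : R :=
  \sum_(w : {ffun 'I_(size E) -> bool})
     (\prod_(i < size E) (if w i then p else 1 - p)) *
     (if `[< joined w x y >] then 1 else 0).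

(* Main.v *)
(** Let [K] be the open cluster of [x] and follow a geodesic word from [x] to
    [y], with [y] outside [K].  Call two boundary edges of [K] adjacent when
    they are close to each other.  For every component [F] of the boundary, the
    parity of the number of crossings of [F] is unchanged when two consecutive
    letters of a word are exchanged, since commutator squares meet [F] evenly;
    so this parity is the same for a word [w] and for its conjugates [u w u^-1].
    Some component [F] is crossed oddly by the geodesic, hence by all of its
    translates that start and end far from [F].  A geodesic is sparse in balls,
    so a component with [l] edges cannot meet all translates by a ball of
    radius [T] when the ball has more than [l (2 T + 1)] points.  Thus a
    crossing at position [i] forces a connected set of closed edges of size of
    the order of [min (i, n - i, log r)], and a Peierls sum concludes.

    The quadratic growth of balls up to radius of the order of [log r] comes
    from the volume hypothesis: if the ball of radius comparable to [t] has
    fewer than [t^2] points, then any two generators satisfy a relation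
    [a x = b y] with [|a|, |b| < t], all long multiples reduce to multiples of
    a single generator, and the ball of radius [r] has at most [3 r t] points. *)

Require Import Defs.
From mathcomp Require Import all_boot all_order all_algebra.
From mathcomp Require Import boolp reals sequences exp.
From mathcomp Require Import zify ring lra.
Import Order.TTheory GRing.Theory Num.Theory.
Local Open Scope ring_scope.

(** * Growth of balls *)

Section Balls.
Variables (G : zmodType) (S : seq G).
Local Notation B n := (sumset (hat S) n).
Implicit Types (a g h x y z : G) (m n t : nat).

Lemma mem_hat_opp a : (- a \in hat S) = (a \in hat S).
Proof.
rewrite /hat !mem_cat !inE oppr_eq0.
have H (b : G) : (- b \in S) = (b \in map -%R S).
  by rewrite -[in RHS](opprK b) (mem_map oppr_inj).
by rewrite -(H (- a)) opprK H; case: (a \in S); case: (a == 0); rewrite ?orbT ?orbF.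
Qed.

Lemma mem0_hat : 0 \in hat S.
Proof. by rewrite /hat mem_cat inE eqxx orbT. Qed.

Lemma mem_hat x : x \in S -> x \in hat S.
Proof. by rewrite /hat mem_cat => ->. Qed.

Lemma sumset_uniq n : uniq (B n).
Proof. by case: n => [|n] //=; exact: undup_uniq. Qed.

Lemma size_sumset (A : seq G) n : (size (sumset A n) <= size A ^ n)%N.
Proof.
elim: n => [|n IH] //=; apply: (leq_trans (size_undup _)).
by rewrite size_allpairs expnS leq_mul2l IH orbT.
Qed.

Lemma sumsetP n g :
  reflect (exists2 u, all (mem (hat S)) u & size u = n /\ \sum_(a <- u) a = g)
          (g \in B n).
Proof.
apply: (iffP idP) => [|[u]].
  elim: n g => [|n IH] g /=.
    by rewrite inE => /eqP->; exists [::]; rewrite ?big_nil.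
  rewrite mem_undup => /allpairsP [[a b] /= [aS /IH [u uS [<- <-]] ->]].
  by exists (a :: u); rewrite /= ?big_cons ?aS.
elim: n g u => [|n IH] g [|a u] /= => [_ [_ <-]|_ []//|_ []//|/andP[aS uS] [[su] <-]].
  by rewrite big_nil inE.
rewrite big_cons mem_undup; apply/allpairsP; exists (a, \sum_(a0 <- u) a0).
by split=> //; apply: (IH _ u).
Qed.

Lemma sumset0 n : 0 \in B n.
Proof.
apply/sumsetP; exists (nseq n 0); first by rewrite all_nseq /= mem0_hat orbT.
by rewrite size_nseq big_nseq; elim: n => [|n [_ IH]] //=; rewrite add0r.
Qed.

Lemma sumsetD m n g h : g \in B m -> h \in B n -> g + h \in B (m + n)%N.
Proof.
move=> /sumsetP[u uS [<- <-]] /sumsetP[v vS [<- <-]].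
by apply/sumsetP; exists (u ++ v); rewrite ?all_cat ?uS // size_cat big_cat.
Qed.

Lemma sumset_le {m n g} : (m <= n)%N -> g \in B m -> g \in B n.
Proof. by move=> mn gm; rewrite -(subnKC mn) -[g]addr0 sumsetD ?sumset0. Qed.

Lemma sumsetN n g : (- g \in B n) = (g \in B n).
Proof.
suff H h : h \in B n -> - h \in B n.
  by apply/idP/idP => [/H|/H //]; rewrite opprK.
move=> /sumsetP[u uS [<- <-]]; apply/sumsetP; exists (map -%R u).
  by rewrite all_map; apply: sub_all uS => b /=; rewrite mem_hat_opp.
by rewrite size_map big_map raddf_sum.
Qed.

Lemma sumset_hat a : a \in hat S -> a \in B 1.
Proof. by move=> aS; apply/sumsetP; exists [:: a]; rewrite /= ?aS // big_seq1. Qed.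

Lemma sumset_word {u} : all (mem (hat S)) u -> \sum_(a <- u) a \in B (size u).
Proof. by move=> uS; apply/sumsetP; exists u. Qed.

Lemma sumsetMn x n : x \in hat S -> x *+ n \in B n.
Proof.
move=> xS; elim: n => [|n IH]; first exact: sumset0.
by rewrite mulrS -add1n sumsetD ?sumset_hat.
Qed.

(** Commutativity lets the letters be collected generator by generator; each letter changes one
    coefficient by at most one. [uniq S] ensures that this change is counted once in the sum. *)
Lemma sumset_coef n g : uniq S -> g \in B n ->
  exists2 c : G -> int, (\sum_(x <- S) `|c x| <= n)%N & g = \sum_(x <- S) x *~ c x.
Proof.
move=> uS /sumsetP[u /allP uh [<- <-]]; elim: u uh => [|a u IH] uh.
  exists (fun=> 0); first by rewrite big1.
  by rewrite big_nil big1.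
have [b bu|c cn cs] := IH; first by apply: uh; rewrite inE bu orbT.
have ah : a \in hat S by apply: uh; rewrite inE eqxx.
have step x (e : int) : x \in S -> `|e|%N = 1%N -> a = x *~ e ->
    exists2 c : G -> int, (\sum_(x <- S) `|c x| <= size (a :: u))%N &
      \sum_(b <- a :: u) b = \sum_(x <- S) x *~ c x.
  move=> xS e1 ae; exists (fun z => c z + (if z == x then e else 0)).
    rewrite /= -addn1; apply: (@leq_trans (\sum_(z <- S) (`|c z| + (if z == x then 1 else 0)))%N).
      by apply: leq_sum => z _; case: eqP => _; lia.
    rewrite big_split leq_add //=.
    by rewrite -big_mkcond /= -big_filter /= (filter_pred1_uniq uS xS) big_seq1.
  rewrite big_cons cs.
  under [RHS]eq_bigr do rewrite mulrzDr.
  rewrite big_split /= addrC; congr (_ + _).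
  transitivity (\sum_(z <- S) (if z == x then a else 0)).
    by rewrite -big_mkcond -big_filter (filter_pred1_uniq uS xS) big_seq1.
  by apply: eq_bigr => z _; case: eqP => [->|].
move: ah; rewrite /hat mem_cat inE => /or3P[aS|/eqP a0|/mapP[x xS ax]].
- exact: (step a 1).
- by exists c; [rewrite (leq_trans cn)|rewrite big_cons a0 add0r].
- by apply: (step x (-1)) => //; rewrite mulrN1z.
Qed.

(** Multiples of [x] can be traded for multiples of [y] at a cost [d] that does not depend on [n].
    Bounding [m] by [n] keeps coefficients from growing when reductions are chained, so that only
    the defects add up. *)
Definition subordinate (d : nat) x y :=
  forall n, exists2 m : int, (`|m| <= n)%N & x *+ n - y *~ m \in B d.

Lemma subordinateW d e x y : (d <= e)%N -> subordinate d x y -> subordinate e x y.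
Proof. by move=> de H n; have [m mn xy] := H n; exists m => //; exact: sumset_le xy. Qed.

Lemma subordinate_int {d x y} : subordinate d x y -> forall n : int,
  exists2 m : int, (`|m| <= `|n|)%N & x *~ n - y *~ m \in B d.
Proof.
move=> H n; have [m mn xy] := H `|n|%N; have [n0|n0] := leP 0 n.
  by exists m => //; rewrite -(gez0_abs n0).
exists (- m); first by rewrite abszN.
have -> : n = - `|n|%N%:Z by lia.
by rewrite !mulrNz -opprD sumsetN.
Qed.

Lemma subordinate_trans {d e x y z} :
  subordinate d x y -> subordinate e y z -> subordinate (d + e) x z.
Proof.
move=> xy yz n; have [m mn H] := xy n; have [j jm H'] := subordinate_int yz m.
exists j; first exact: leq_trans mn.
by rewrite -(subrK (y *~ m) (x *+ n)) -addrA sumsetD.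
Qed.

Lemma subordinate_refl d x : subordinate d x x.
Proof. by move=> n; exists n => //; rewrite subrr sumset0. Qed.

(** Divide [n] by [a]: each block of [a] copies of [x] becomes [b] copies of [y], and the remainder,
    below [t], is left as a word in [x]. *)
Lemma relation_subordinate x y (a t : nat) (b : int) : x \in hat S ->
  (0 < a <= t)%N -> (`|b| <= a)%N -> x *+ a = y *~ b -> subordinate t x y.
Proof.
move=> xS /andP[a0 at_] ba ab n; exists (b * (n %/ a)%N%:Z).
  rewrite abszM; apply: (leq_trans (leq_mul ba (leqnn _))).
  by rewrite mulnC leq_trunc_div.
rewrite mulrzA -ab {1}(divn_eq n a) mulrnDr mulnC mulrnA -pmulrn addrC addKr.
by apply: sumset_le (sumsetMn _ _ xS); rewrite (leq_trans (ltnW (ltn_pmod n a0))).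
Qed.

(** Pigeonhole: the [t ^ 2] combinations of [x] and [y] with coefficients below [t] lie in a ball
    with fewer points. Two coincide, and their difference is a nontrivial relation; the generator
    with the larger coefficient is subordinate to the other. *)
Lemma subordinate_total t x y : x \in hat S -> y \in hat S ->
  (size (B (2 * t)%N) < t ^ 2)%N -> subordinate t x y \/ subordinate t y x.
Proof.
move=> xS yS small.
pose P := [seq (i, j) | i <- iota 0 t, j <- iota 0 t].
pose f (p : nat * nat) := x *+ p.1 + y *+ p.2.
have uP : uniq P by apply: allpairs_uniq; rewrite ?iota_uniq // => -[? ?] [? ?].
have PP p : p \in P -> (p.1 < t)%N && (p.2 < t)%N.
  by move=> /allpairsP[[a b] /= [+ + ->]]; rewrite !mem_iota /= => -> ->.
have [p [q [pP qP pq fpq]]] : exists p q, [/\ p \in P, q \in P, p <> q & f p = f q].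
  apply: contrapT => H; move: small; rewrite ltnNge => /negP; apply.
  have -> : (t ^ 2)%N = size (map f P) by rewrite size_map size_allpairs size_iota mulnn.
  apply: uniq_leq_size.
    rewrite map_inj_in_uniq // => p q pP qP fpq; apply: contrapT => pq.
    by apply: H; exists p, q.
  move=> _ /mapP[p /PP /andP[p1 p2] ->]; rewrite mul2n -addnn sumsetD //.
    exact: sumset_le (ltnW p1) (sumsetMn _ _ xS).
  exact: sumset_le (ltnW p2) (sumsetMn _ _ yS).
have {PP} [/andP[p1 p2] /andP[q1 q2]] := (PP _ pP, PP _ qP).
pose A : int := p.1%:Z - q.1%:Z; pose Bz : int := q.2%:Z - p.2%:Z.
have rel : x *~ A = y *~ Bz.
  rewrite /A /Bz !mulrzBr -!pmulrn; apply/eqP; rewrite subr_eq; apply/eqP.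
  move: fpq; rewrite /f => fpq; apply: (addIr (y *+ p.2)).
  by rewrite fpq addrAC subrK addrC.
have sub u v (a b : int) : u \in hat S -> u *~ a = v *~ b ->
    (0 < `|a| <= t)%N -> (`|b| <= `|a|)%N -> subordinate t u v.
  move=> uS ab a0 ba; have [ge|lt] := leP 0 a.
    by apply: (@relation_subordinate u v `|a|%N _ b) => //; rewrite -ab pmulrn gez0_abs.
  apply: (@relation_subordinate u v `|a|%N _ (- b)); rewrite ?abszN //.
  by rewrite mulrNz -ab -mulrNz pmulrn; congr (_ *~ _); lia.
have nz : (A != 0) || (Bz != 0).
  apply: contra_notT pq; rewrite negb_or !negbK /A /Bz => /andP[/eqP e1 /eqP e2].
  by case: (p) (q) e1 e2 => [? ?] [? ?] /= e1 e2; congr pair; lia.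
have [le|lt] := leqP `|Bz| `|A|; [left|right].
  by apply: (sub _ _ A Bz) => //; rewrite /A /Bz in nz le *; lia.
by apply: (sub _ _ Bz A) => //; rewrite /A /Bz in nz lt *; lia.
Qed.

(** Each new element is compared with the current maximum only. If it wins, every earlier reduction
    is composed with one more of defect [t], hence the factor [size s]. *)
Lemma subordinate_max t (s : seq G) : s != [::] ->
  {in s &, forall x y, subordinate t x y \/ subordinate t y x} ->
  exists2 y, y \in s & {in s, forall x, subordinate (size s * t) x y}.
Proof.
elim: s => [//|z s IH] _ tot; have [s0|s0] := eqVneq s [::].
  exists z; first by rewrite inE eqxx.
  by move=> x; rewrite s0 inE => /eqP->; exact: subordinate_refl.
have sz x : x \in s -> x \in z :: s by rewrite inE => ->; rewrite orbT.
have zz : z \in z :: s by rewrite inE eqxx.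
have [x y xs ys|y ys ymax] := IH s0; first by apply: tot; exact: sz.
have [zy|yz] := tot z y zz (sz _ ys).
  exists y; first exact: sz.
  move=> x; rewrite inE => /predU1P[->|xs].
    by apply: subordinateW zy; rewrite /= leq_pmull.
  by apply: subordinateW (ymax _ xs); rewrite /= leq_mul2r leqnSn orbT.
exists z => // x; rewrite inE => /predU1P[->|xs]; first exact: subordinate_refl.
by rewrite /= mulSn addnC; exact: subordinate_trans (ymax _ xs) yz.
Qed.

(** All generators reduce to a single [y] with defect [k * t], so an element of the ball of radius
    [r] is a multiple of [y] up to [k * (k * t)]. Rounding the coefficient to a multiple of [t]
    costs [t] more, and about [2 * r / t] rounded coefficients remain. *)
Lemma linear_growth r t : uniq S -> S != [::] -> (0 < t)%N ->
  (size (B ((size S ^ 2).+1 * t)) < t ^ 2)%N ->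
  (size (B r) <= (2 * (r %/ t)).+1 * size (B ((size S ^ 2).+1 * t)))%N.
Proof.
set k := size S => uS S0 t0 small.
have k0 : (0 < k)%N by rewrite lt0n size_eq0.
have [x y xS yS|y yS ymax] := @subordinate_max t S S0.
  apply: subordinate_total; rewrite ?mem_hat //; apply: leq_ltn_trans small.
  apply: uniq_leq_size (sumset_uniq _) _ => g; apply: sumset_le.
  by rewrite leq_mul2r ltnS expn_gt0 k0 orbT.
set q := (r %/ t)%N.
(* The shift by [q] lets the naturals [j] run through the integers from [-q] to [q]. *)
pose Z := [seq y *~ ((j%:Z - q%:Z) * t%:Z) + b | j <- iota 0 (2 * q).+1, b <- B ((k ^ 2).+1 * t)].
have <- : size Z = ((2 * q).+1 * size (B ((k ^ 2).+1 * t)))%N.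
  by rewrite size_allpairs size_iota.
apply: uniq_leq_size (sumset_uniq _) _ => g /(sumset_coef _ _ uS)[c cr ->].
have [m mr gm] : exists2 m : int, (`|m| <= r)%N &
    \sum_(x <- S) x *~ c x - y *~ m \in B (k * (k * t)).
  have comb (s : seq G) : {subset s <= S} ->
      exists2 m : int, (`|m| <= \sum_(x <- s) `|c x|)%N &
        \sum_(x <- s) x *~ c x - y *~ m \in B (size s * (k * t)).
    elim: s => [|z s IH] sS; first by exists 0; rewrite ?big_nil // subr0 sumset0.
    have [x xs|m mc Hm] := IH; first by apply: sS; rewrite inE xs orbT.
    have [|j jc Hj] := subordinate_int (ymax z _) (c z); first by apply: sS; rewrite inE eqxx.
    exists (j + m); first by rewrite big_cons; lia.
    by rewrite big_cons /= mulSn mulrzDr opprD addrACA sumsetD.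
  have [//|m mc Hm] := comb S; exists m => //; exact: leq_trans cr.
(* The absolute value is divided, so rounding goes towards zero and the bound by [q] also holds for
   negative [m]. *)
have [n [s [nq st mE]]] : exists n s : int, [/\ (`|n| <= q)%N, (`|s| <= t)%N & m = n * t%:Z + s].
  have := divn_eq `|m| t; have := ltn_pmod `|m| t0.
  have := leq_div2r t mr; rewrite -/q.
  move: (`|m| %/ t)%N (`|m| %% t)%N => a b aq bt mab.
  have [m0|m0] := leP 0 m.
    by exists a, b; split; rewrite ?absz_nat //; [exact: ltnW|rewrite -PoszM -PoszD -mab gez0_abs].
  exists (- a%:Z), (- b%:Z); split; rewrite ?abszN ?absz_nat //; first exact: ltnW.
  by rewrite mulNr -opprD -PoszM -PoszD -mab; lia.
apply/allpairsP; exists (absz (n + q%:Z), \sum_(x <- S) x *~ c x - y *~ (n * t%:Z)); split.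
- by rewrite mem_iota /=; lia.
- rewrite [snd _]/= mulSn expnS expn1 -mulnA addnC -(subrK (y *~ m) (\sum_(x <- S) _)) -addrA sumsetD //.
  rewrite mE mulrzDr addrAC subrr add0r.
  have [s0|s0] := leP 0 s.
    by rewrite -(gez0_abs s0) -pmulrn; apply: sumset_le st (sumsetMn _ _ (mem_hat _ yS)).
  rewrite -sumsetN -mulrNz (_ : - s = `|s|%N%:Z); last lia.
  by rewrite -pmulrn; apply: sumset_le st (sumsetMn _ _ (mem_hat _ yS)).
- by rewrite /= (_ : (absz (n + q%:Z))%:Z - q%:Z = n) 1?addrC ?subrK //; lia.
Qed.

End Balls.

(** * Crossing parities and walks *)

Section Words.
Variable G : zmodType.

(* the edge from [v] to [v + s] is encoded as [(v, s)] *)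
Fixpoint edges (v : G) (u : seq G) : seq (G * G) :=
  if u is s :: u' then (v, s) :: edges (v + s) u' else [::].

Definition parity (F : pred (G * G)) v u := odd (count F (edges v u)).

Lemma size_edges v u : size (edges v u) = size u.
Proof. by elim: u v => //= s u IH v; rewrite IH. Qed.

Lemma nth_edges v u i : (i < size u)%N ->
  nth (0, 0) (edges v u) i = (v + \sum_(a <- take i u) a, nth 0 u i).
Proof.
elim: u v i => [|s u IH] v [|i] //= iu; first by rewrite big_nil addr0.
by rewrite IH // big_cons addrA.
Qed.

Lemma edgesP v u f : f \in edges v u ->
  exists2 i, (i < size u)%N & f = (v + \sum_(a <- take i u) a, nth 0 u i).
Proof.
move=> /(nthP (0, 0))[i]; rewrite size_edges => iu <-.
by exists i => //; rewrite nth_edges.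
Qed.

Lemma parity_nil F v : parity F v [::] = false. Proof. by []. Qed.

Lemma parity_cons F v s u :
  parity F v (s :: u) = F (v, s) (+) parity F (v + s) u.
Proof. by rewrite /parity /= oddD; case: (F _). Qed.

(** Telescoping modulo 2: a word crosses the boundary of [K] an odd number of times exactly when its
    endpoints lie on different sides. *)
Lemma parity_coboundary (K : pred G) v u :
  parity (fun f => K f.1 (+) K (f.1 + f.2)) v u = K v (+) K (v + \sum_(a <- u) a).
Proof.
elim: u v => [|s u IH] v; first by rewrite big_nil addr0 addbb.
by rewrite parity_cons IH big_cons /= addrA -addbA addKb.
Qed.

(** The last hypothesis says that commutator squares meet [F] evenly, so swapping adjacent letters
    preserves the parity. One letter is moved across [w] first ([one]), then the letters of [u] in
    turn. *)
Lemma parity_exchange F (A : seq G) v u w : {subset u <= A} -> {subset w <= A} ->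
  (forall v, {in A &, forall s t,
     F (v, s) (+) F (v + s, t) = F (v, t) (+) F (v + t, s)}) ->
  parity F v u (+) parity F (v + \sum_(a <- u) a) w =
  parity F v w (+) parity F (v + \sum_(a <- w) a) u.
Proof.
move=> uA wA sq.
have one z t : t \in A ->
    F (z, t) (+) parity F (z + t) w = parity F z w (+) F (z + \sum_(a <- w) a, t).
  move=> tA; elim: w wA z => [|s w IH] wA z; first by rewrite big_nil addr0 addbC.
  have sA : s \in A by apply: wA; rewrite inE eqxx.
  rewrite !parity_cons addbA sq // -addbA addrAC IH; first by rewrite big_cons !addrA addbA.
  by move=> b bw; apply: wA; rewrite inE bw orbT.
elim: u uA v => [|t u IH] uA v.
  by rewrite big_nil addr0 !parity_nil addbF.
have tA : t \in A by apply: uA; rewrite inE eqxx.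
rewrite !parity_cons big_cons addrA -addbA IH; last first.
  by move=> b bu; apply: uA; rewrite inE bu orbT.
by rewrite addbA one // -addbA addrAC.
Qed.

Lemma parityP F v u : parity F v u ->
  exists2 i, (i < size u)%N & F (v + \sum_(a <- take i u) a, nth 0 u i).
Proof.
move=> odd_F; have /hasP[f /edgesP[i iu ->] Ff] : has F (edges v u).
  by rewrite has_count; move: odd_F; rewrite /parity; case: count.
by exists i.
Qed.

End Words.

(** The class sizes add up to an odd number, so one of them is odd; the induction discards a class
    of even size. The two conditions make [R] an equivalence on the elements satisfying [P]. *)
Lemma odd_class (T : eqType) (P : pred T) (R : rel T) (s : seq T) :
  (forall e, P e -> R e e) ->
  (forall e f g, R e f -> R e g -> R f g) ->
  odd (count P s) ->
  exists e, [/\ e \in s, P e & odd (count (predI P (R e)) s)].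
Proof.
move=> Rr Rt; have [n] := ubnP (size s); elim: n s => // n IH s sn oddP.
have /hasP[e es Pe] : has P s by rewrite has_count; case: count oddP.
have [odde|evene] := boolP (odd (count (predI P (R e)) s)); first by exists e.
pose s' := filter (predC (R e)) s.
have cs (Q : pred T) : count Q s = (count (predI Q (R e)) s + count Q s')%N.
  rewrite count_filter; elim: (s) => //= x r ->.
  by case: (Q x); case: (R e x) => /=; lia.
have [] := IH s'.
- rewrite ltnS in sn; apply: leq_trans sn; rewrite -(count_predC (R e) s) size_filter -[ltnLHS]add0n ltn_add2r.
  by rewrite -has_count; apply/hasP; exists e => //; exact: Rr.
- by move: oddP; rewrite cs oddD (negbTE evene).
move=> f []; rewrite mem_filter /= => /andP[nef fs] Pf oddf.
exists f; split=> //; rewrite cs oddD oddf addbT.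
(* Nothing of the class of [f] was discarded: a common element would relate [e] to [f], and [f]
   would have been discarded too. *)
rewrite (_ : count _ s = 0%N) //; apply/eqP; rewrite -leqn0 leqNgt -has_count.
apply/hasP => -[g _ /= /andP[/andP[_ Rfg] Reg]]; move/negP: nef; apply.
have Reg' : R g e by apply: Rt Reg (Rr _ Pe).
have Rgf : R g f by apply: Rt Rfg (Rr _ Pf).
exact: Rt Reg' Rgf.
Qed.

Section Walks.
Variables (T : choiceType) (adj : rel T).

Definition reach e f : bool := `[< exists2 s, path adj e s & last e s = f >].

Lemma reachP e f : reflect (exists2 s, path adj e s & last e s = f) (reach e f).
Proof. exact: asboolP. Qed.

Lemma reach_refl e : reach e e. Proof. by apply/reachP; exists [::]. Qed.

Lemma reach_trans e f g : reach e f -> reach f g -> reach e g.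
Proof.
move=> /reachP[s ps <-] /reachP[s' ps' <-]; apply/reachP; exists (s ++ s').
  by rewrite cat_path ps.
by rewrite last_cat.
Qed.

Lemma reach1 e f : adj e f -> reach e f.
Proof. by move=> ef; apply/reachP; exists [:: f]; rewrite //= ef. Qed.

Lemma reach_sym e f : symmetric adj -> reach e f -> reach f e.
Proof.
move=> sym /reachP[s + <-]; elim: s e => [|g s IH] e /=; first by rewrite reach_refl.
by case/andP=> eg /IH H; apply: reach_trans H (reach1 _ _ _); rewrite sym.
Qed.

(* Inserting a detour [v, g, v] at a visited vertex [v] adds one new vertex to a
   walk and two steps; the process stops only when the component is exhausted. *)
Lemma covering_walk e l : symmetric adj ->
  (exists s, [/\ path adj e s, size s = (2 * l)%N & size (undup (e :: s)) = l.+1]) \/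
  (exists s, [/\ path adj e s, (size s <= 2 * l)%N, (size (undup (e :: s)) <= l)%N
     & forall f, reach e f -> f \in e :: s]).
Proof.
move=> sym; elim: l => [|l [] [s [ps ss us]]]; first by left; exists [::].
  have [[v [g [vs gs vg]]]|no] :=
    pselect (exists v g, [/\ v \in e :: s, g \notin e :: s & adj v g]).
    left; case/splitPl: vs ps ss us gs => p1 p2 lv.
    rewrite cat_path lv => /andP[pp1 pp2] ss us gs.
    exists (p1 ++ [:: g, v & p2]); split.
    - by rewrite cat_path pp1 lv /= vg sym vg.
    - by move: ss; rewrite !size_cat /=; lia.
    - rewrite -us -[RHS]/(size (g :: undup (e :: p1 ++ p2))).
      apply/perm_size/uniq_perm; rewrite ?undup_uniq //.
        by rewrite cons_uniq mem_undup gs undup_uniq.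
      move=> h; rewrite mem_undup !inE mem_undup !inE !mem_cat !inE.
      have [->|_] := eqVneq h v.
        have : v \in e :: p1 by rewrite -lv mem_last.
        by rewrite inE => /orP[]->; rewrite ?orbT.
      by case: (h == e); case: (h == g); case: (h \in p1).
  right; exists s; split=> //; first lia; first lia.
  suff H u h : path adj h u -> h \in e :: s -> last h u \in e :: s.
    by move=> f /reachP[u pu <-]; apply: H; rewrite // inE eqxx.
  elim: u h => //= g u IH h /andP[hg gu] hs; apply: IH => //.
  by apply: contrapT => /negP gs; apply: no; exists h, g.
by move=> H; right; exists s; split=> //; lia.
Qed.

End Walks.

Lemma size_bounded_diam (s : seq nat) D : uniq s ->
  {in s &, forall i j, (i <= j + D)%N} -> (size s <= D.+1)%N.
Proof.
move=> us diam; have [->//|s0] := eqVneq s [::].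
have exs : exists n, n \in s by case: (s) s0 => // a s' _; exists a; rewrite inE eqxx.
case: (ex_minnP exs) => m ms mmin; rewrite -(size_iota m D.+1).
apply: uniq_leq_size => // j js; rewrite mem_iota mmin //=.
by have := diam j m js ms; lia.
Qed.

(** * Boundary components crossed by a geodesic *)

Section Cut.
Variables (G : zmodType) (S : seq G) (K : pred G).
Local Notation B n := (sumset (hat S) n).
Implicit Types (e f g : G * G) (u w : seq G).

Definition geodesic w := forall d, \sum_(a <- w) a \in B d -> (size w <= d)%N.

(** Otherwise the letters between positions [i] and [j] could be replaced by [d] letters, giving a
    shorter word with the same sum. *)
Lemma geodesic_take w i j d : all (mem (hat S)) w -> geodesic w ->
  (i <= size w)%N -> (j <= size w)%N ->
  \sum_(a <- take j w) a - \sum_(a <- take i w) a \in B d -> (j <= i + d)%N.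
Proof.
move=> wS geo iw jw Hd.
have takeS n : all (mem (hat S)) (take n w) && all (mem (hat S)) (drop n w).
  by rewrite -all_cat cat_take_drop.
have /andP[/sumset_word Hi _] := takeS i; have /andP[_ /sumset_word Hj] := takeS j.
rewrite size_takel // in Hi; rewrite size_drop in Hj.
have := geo (i + d + (size w - j))%N.
rewrite -[in \sum_(a <- w) a](cat_take_drop j w) big_cat /=.
rewrite -[\sum_(a <- take j w) a](subrKC (\sum_(a <- take i w) a)).
by rewrite !sumsetD // => /(_ isT); lia.
Qed.

Definition boundary f := K f.1 (+) K (f.1 + f.2).

(** Radius 2 makes any two boundary edges of a commutator square adjacent. The remaining conditions
    keep walks on boundary edges labelled by letters, so that degrees are bounded in terms of
    [hat S] alone. *)
Definition near f g :=
  [&& g.1 - f.1 \in B 2, f.2 \in hat S, g.2 \in hat S, boundary f & boundary g].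

Lemma near_sym : symmetric near.
Proof.
move=> f g; rewrite /near -(sumsetN _ _ _ (f.1 - g.1)) opprB.
by case: (_ \in B 2); case: (f.2 \in _); case: (g.2 \in _); case: (boundary f); case: (boundary g).
Qed.

Lemma near_path e s f : path near e s -> f \in e :: s -> f.1 - e.1 \in B (2 * size s).
Proof.
elim: s e f => [|g s IH] e f; first by rewrite inE => _ /eqP->; rewrite subrr sumset0.
rewrite [path _ _ _]/= => /andP[/and5P[eg _ _ _ _] gs]; rewrite inE => /predU1P[->|fs].
  by rewrite subrr sumset0.
by rewrite -(subrK g.1 f.1) -addrA mulnS addnC sumsetD ?IH.
Qed.

Definition component e f := boundary f && reach _ near e f.

(** If the component contains an edge of the square, it contains all boundary edges of the square,
    and a coboundary sums to zero around a square. Otherwise all four terms vanish. *)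
Lemma component_square e v : {in hat S &, forall s t,
  component e (v, s) (+) component e (v + s, t) =
  component e (v, t) (+) component e (v + t, s)}.
Proof.
move=> s t sS tS.
pose sq := [:: (v, s); (v + s, t); (v, t); (v + t, s)].
have sqS f : f \in sq -> f.2 \in hat S by rewrite !inE => /or4P[] /eqP->.
have sqV f : f \in sq -> exists2 c, c \in hat S & f.1 = v + c.
  rewrite !inE => /or4P[] /eqP->; [exists 0|exists s|exists 0|exists t] => //;
  by rewrite ?addr0 ?mem0_hat.
have sqB f g : f \in sq -> g \in sq -> f.1 - g.1 \in B 2.
  move=> /sqV[c cS ->] /sqV[d dS ->]; rewrite opprD addrACA subrr add0r.
  by rewrite -[2%N]/(1 + 1)%N sumsetD ?sumsetN ?sumset_hat.
have [/hasP[f fsq /andP[bf ef]]|no] := boolP (has (component e) sq).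
  have cE g : g \in sq -> component e g = boundary g.
    move=> gsq; rewrite /component; case bg: (boundary g) => //=.
    by apply: reach_trans ef (reach1 _ _ _ _ _); rewrite /near sqB ?sqS ?bf ?bg.
  rewrite !cE ?inE ?eqxx ?orbT // /boundary /= addrAC.
  by case: (K v); case: (K (v + s)); case: (K (v + t)); case: (K _).
move: no; rewrite /= !negb_or => /and5P[/negbTE-> /negbTE-> /negbTE-> /negbTE-> _].
by [].
Qed.

Lemma boundary_walk x w (l : nat -> nat) :
  all (mem (hat S)) w -> geodesic w -> K x -> ~~ K (x + \sum_(a <- w) a) ->
  (forall i, (i < size w)%N -> (0 < l i)%N -> exists T,
    [/\ (l i * (2 * T).+1 < size (B T))%N, (T + 4 * l i < i)%N
      & (i + (T + 4 * l i) < size w)%N]) ->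
  exists i s (e := (x + \sum_(a <- take i w) a, nth 0 w i)),
    [/\ (i < size w)%N, boundary e, path near e s, size s = (2 * l i)%N &
        size (undup (e :: s)) = (l i).+1].
Proof.
move=> wS geo Kx Ky large.
have wsub : {subset w <= hat S} by move=> a aw; exact: (allP wS).
have oddb : parity G boundary x w by rewrite parity_coboundary Kx (negbTE Ky).
have nsym e f g : reach _ near e f -> reach _ near e g -> reach _ near f g.
  by move=> ef eg; apply: reach_trans eg; apply: reach_sym ef; exact: near_sym.
(* The geodesic leaves [K], so it crosses the boundary oddly, hence also some component. *)
have [e [ew be odde]] := odd_class _ _ _ _ (fun e _ => reach_refl _ near e) nsym oddb.
have [i iw eE] := edgesP _ _ _ _ ew.
have [[s [ps ss us]]|[s [ps ss us cover]]] := covering_walk _ near e (l i) near_sym.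
  by exists i, s; rewrite -eE.
(* From here on the component of [e] is exhausted by at most [l i] edges, and a contradiction is
   sought. *)
have l0 : (0 < l i)%N.
  apply: leq_trans us; rewrite lt0n size_eq0; apply/eqP => H.
  by have := mem_undup (e :: s) e; rewrite H inE eqxx.
have [T [cardT Tx Ty]] := large i iw l0.
have far f : component e f -> f.1 - e.1 \in B (4 * l i).
  move=> /andP[_ /cover fs]; apply: sumset_le (near_path _ _ _ ps fs).
  by rewrite -[4%N]/(2 * 2)%N -mulnA leq_mul2l.
have e1 : e.1 = x + \sum_(a <- take i w) a by rewrite eE.
have e1B : e.1 - x \in B i.
  rewrite e1 addrAC subrr add0r -[X in B X](size_takel (ltnW iw)).
  by apply: sumset_word; move: wS; rewrite -{1}(cat_take_drop i w) all_cat => /andP[].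
(* Exchange [w] with a word [u] for [z]. The component lies farther than [T] from both ends of the
   geodesic, so neither copy of [u] meets it, and the translate of [w] by [z] crosses it oddly. *)
have hitsz z : z \in B T -> exists2 j, (j < size w)%N &
    component e (x + z + \sum_(a <- take j w) a, nth 0 w j).
  move=> /sumsetP[u uS [uT uz]]; apply: parityP; rewrite -uz.
  have usub : {subset u <= hat S} by move=> a au; exact: (allP uS).
  have := parity_exchange _ _ _ x u w usub wsub (component_square e).
  rewrite -/(parity G (component e) x w) in odde; rewrite odde.
  have inB j : \sum_(a <- take j u) a \in B T.
    rewrite -uT; apply: (@sumset_le _ _ (size (take j u))); first by rewrite size_take_min geq_minr.
    by apply: sumset_word; move: uS; rewrite -{1}(cat_take_drop j u) all_cat => /andP[].
  have -> : parity G (component e) x u = false.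
    apply: contraTF Tx => /parityP[j _ /far /= Hj]; rewrite -leqNgt.
    apply: (@geodesic_take w 0 i (T + 4 * l i)) => //; first exact: ltnW.
    rewrite take0 big_nil subr0.
    rewrite (_ : \sum_(a <- take i w) a = e.1 - x); last by rewrite e1 addrAC subrr add0r.
    rewrite (_ : e.1 - x = \sum_(a <- take j u) a - (x + \sum_(a <- take j u) a - e.1)).
      by rewrite sumsetD // sumsetN.
    by rewrite opprB opprD addrCA [X in _ = _ + X]addrCA subrr addr0.
  have -> : parity G (component e) (x + \sum_(a <- w) a) u = false.
    apply: contraTF Ty => /parityP[j _ /far /= Hj]; rewrite -leqNgt.
    apply: (@geodesic_take w i (size w) (T + 4 * l i)) => //; first exact: ltnW.
    rewrite take_size.
    rewrite (_ : _ - _ = - \sum_(a <- take j u) a +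
       (x + \sum_(a <- w) a + \sum_(a <- take j u) a - e.1)).
      by rewrite sumsetD // sumsetN.
    by rewrite e1 addrA [- _ + _]addrC addrK opprD addrACA subrr add0r.
  by [].
pose vis := undup (e :: s).
pose near_idx f := [seq j <- iota 0 (size w) | f.1 - (x + \sum_(a <- take j w) a) \in B T].
(* A translate is recovered from an edge that it hits and the position of the hit. For a fixed edge
   these positions differ by at most [2 * T], since [w] is geodesic. *)
pose Z := flatten [seq [seq f.1 - (x + \sum_(a <- take j w) a) | j <- near_idx f] | f <- vis].
have : (size (B T) <= size Z)%N.
  apply: uniq_leq_size (sumset_uniq _ _ _) _ => z zT; have [j jw cj] := hitsz z zT.
  have /andP[_ /cover vj] := cj.
  set f := (X in component e X) in cj vj.
  have fz : f.1 - (x + \sum_(a <- take j w) a) = z.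
    by rewrite /f /= -(addrA x z) opprD addrACA subrr add0r addrK.
  apply/flatten_mapP; exists f; first by rewrite mem_undup.
  by apply/mapP; exists j; rewrite ?fz // mem_filter fz zT mem_iota.
suff : (size Z <= l i * (2 * T).+1)%N by lia.
rewrite /Z size_flatten /shape -map_comp sumnE big_map.
apply: (@leq_trans (\sum_(f <- vis) (2 * T).+1)%N); last first.
  by rewrite big_const_seq count_predT iter_addn_0 mulnC leq_mul2r us orbT.
apply: leq_sum => f _; rewrite /= size_map; apply: size_bounded_diam.
  by rewrite filter_uniq ?iota_uniq.
move=> j1 j2; rewrite !mem_filter !mem_iota /= => /andP[H1 j1w] /andP[H2 j2w].
apply: (@geodesic_take w) => //; [exact: ltnW|exact: ltnW|].
rewrite mul2n -addnn (_ : _ - _ = (f.1 - (x + \sum_(a <- take j2 w) a)) -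
  (f.1 - (x + \sum_(a <- take j1 w) a))); first by rewrite sumsetD ?sumsetN.
by rewrite opprB [RHS]addrC addrA subrK opprD addrACA subrr add0r.
Qed.

End Cut.

(** * Union bound over closed walks *)

(** The indicator is a product over edges, so the sum over configurations factors into one-edge
    sums: [1 - p] for an edge of [J], and 1 for any other. *)
Lemma prob_closed (R : realType) (p : R) n (J : {set 'I_n}) :
  \sum_(w : {ffun 'I_n -> bool}) (\prod_(i < n) (if w i then p else 1 - p)) *
     (if [forall i in J, ~~ w i] then 1 else 0) = (1 - p) ^+ #|J|.
Proof.
pose F (i : 'I_n) (b : bool) : R :=
  (if b then p else 1 - p) * (if (i \in J) && b then 0 else 1).
transitivity (\sum_(w : {ffun 'I_n -> bool}) \prod_(i < n) F i (w i)).
  apply: eq_bigr => w _; rewrite big_split /=; congr (_ * _).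
  have [/forall_inP all0|] := boolP [forall i in J, ~~ w i].
    by rewrite big1 // => i _; case: ifP => // /andP[/all0 /negbTE ->].
  rewrite negb_forall_in => /exists_inP[i iJ /negPn wi].
  by rewrite (bigD1 i) //= iJ wi mul0r.
rewrite -(bigA_distr_bigA F) /= -prodr_const [RHS]big_mkcond /=.
by apply: eq_bigr => i _; rewrite big_bool /F /= andbT andbF; case: ifP => _; ring.
Qed.

(** Pointwise, 1 is at most the indicator of joining plus the number of closed sets in [L];
    averaging gives the bound. *)
Lemma perc_prob_union (R : realType) (G : zmodType) (E : seq (G * G)) (p : R) x y
    (L : seq {set 'I_(size E)}) : 0 <= p <= 1 ->
  (forall w : {ffun 'I_(size E) -> bool}, ~ joined w x y ->
     exists2 J, J \in L & {in J, forall i, ~~ w i}) ->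
  1 - \sum_(J <- L) (1 - p) ^+ #|J| <= perc_prob E p x y.
Proof.
move=> /andP[p0 p1] bad; rewrite lerBlDr /perc_prob.
under [X in _ + X]eq_bigr do rewrite -prob_closed.
rewrite exchange_big -big_split /=.
have tot : \sum_(w : {ffun 'I_(size E) -> bool})
   (\prod_(i < size E) (if w i then p else 1 - p)) = 1.
  (* Total mass 1 is the case of the empty set of closed edges. *)
  transitivity ((1 - p) ^+ #|set0 : {set 'I_(size E)}|); last by rewrite cards0.
  rewrite -prob_closed; apply: eq_bigr => w _.
  by rewrite (_ : [forall _ in _, _]) ?mulr1 //; apply/forall_inP => i; rewrite inE.
rewrite -[leLHS]tot; apply: ler_sum => w _; rewrite -mulr_sumr -mulrDr.
have w0 : 0 <= \prod_(i < size E) (if w i then p else 1 - p).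
  by apply: prodr_ge0 => i _; case: ifP => _ //; rewrite subr_ge0.
apply: ler_peMr => //.
have s0 (r : seq {set 'I_(size E)}) :
    0 <= \sum_(J <- r) (if [forall i in J, ~~ w i] then 1 else 0) :> R.
  by apply: sumr_ge0 => J _; case: ifP.
case: asboolP => [_|/bad[J JL Jw]]; first by rewrite lerDl.
rewrite add0r (big_rem J) //= (_ : [forall i in J, ~~ w i]) ?lerDl //.
by apply/forall_inP.
Qed.

Section Matching.
Variables (G : zmodType) (E : seq (G * G)).

Definition matches (f : G * G) (i : 'I_(size E)) :=
  (nth (0, 0) E i == (f.1, f.1 + f.2)) || (nth (0, 0) E i == (f.1 + f.2, f.1)).

Definition edge_set (s : seq (G * G)) := [set i | has (matches^~ i) s].

(** A stored edge is matched by at most two oriented encodings, one from each endpoint. *)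
Lemma size_edge_set s : {in s, forall f, exists i, matches f i} ->
  (size (undup s) <= 2 * #|edge_set s|)%N.
Proof.
move=> sE.
pose pairs (i : 'I_(size E)) := let u := nth (0, 0) E i in
  [:: (u.1, u.2 - u.1); (u.2, u.1 - u.2)].
apply: (@leq_trans (size (flatten [seq pairs i | i <- enum (edge_set s)]))).
  apply: uniq_leq_size (undup_uniq _) _ => f; rewrite mem_undup => fs.
  have [i fi] := sE f fs; apply/flatten_mapP; exists i.
    by rewrite mem_enum inE; apply/hasP; exists f.
  case: f fi {fs} => v t; rewrite /pairs !inE /matches /= => /orP[] /eqP-> /=.
    by rewrite addrC addKr eqxx.
  by rewrite [in X in _ || X]addrC addKr eqxx orbT.
rewrite size_flatten /shape -map_comp sumnE big_map.
under eq_bigr do rewrite /=.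
by rewrite big_const_seq count_predT iter_addn_0 cardE.
Qed.

End Matching.

Fixpoint walks (T : Type) (nb : T -> seq T) (e : T) (n : nat) : seq (seq T) :=
  if n is n'.+1 then flatten [seq [seq f :: s | s <- walks T nb f n'] | f <- nb e]
  else [:: [::]].

Lemma size_walks (T : Type) (nb : T -> seq T) b e n :
  (forall f, size (nb f) <= b)%N -> (size (walks T nb e n) <= b ^ n)%N.
Proof.
move=> nbb; elim: n e => [|n IH] e //=.
rewrite size_flatten /shape -map_comp sumnE big_map expnS.
apply: (@leq_trans (\sum_(f <- nb e) b ^ n)%N).
  by apply: leq_sum => f _; rewrite /= size_map.
by rewrite big_const_seq count_predT iter_addn_0 mulnC leq_mul2r nbb orbT.
Qed.

Lemma mem_walks (T : eqType) (nb : T -> seq T) e s :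
  path (fun f g => g \in nb f) e s -> s \in walks T nb e (size s).
Proof.
elim: s e => [|f s IH] e /=; first by rewrite inE.
move=> /andP[ef /IH sf]; apply/flatten_mapP; exists f => //.
by apply/mapP; exists s.
Qed.

Lemma mem_edges_in (G : zmodType) (S A : seq G) u v :
  u \in A -> v \in A -> u != v -> v - u \in hat S ->
  (u, v) \in edges_in S A \/ (v, u) \in edges_in S A.
Proof.
move=> uA vA uv uvS.
have adj : cay_adj S u v /\ cay_adj S v u.
  rewrite /cay_adj !subr_eq0 uv eq_sym uv /=.
  move: uvS; rewrite /hat mem_cat inE subr_eq0 eq_sym (negbTE uv) /=.
  have -> : (v - u \in map -%R S) = (u - v \in S).
    by rewrite -(opprB u v) (mem_map oppr_inj).
  by rewrite orbC => H; split; rewrite // orbC.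
have mem a b : a \in A -> b \in A -> cay_adj S a b ->
    (index a (undup A) < index b (undup A))%N -> (a, b) \in edges_in S A.
  move=> aA bA ab lt; rewrite mem_filter /= lt ab /=.
  by apply/allpairsP; exists (a, b); rewrite /= !mem_undup.
case: adj => a1 a2; case: (ltngtP (index u (undup A)) (index v (undup A))) => H.
- by left; exact: mem.
- by right; exact: mem.
- move/eqP: uv; case; rewrite -(nth_index 0 (s := undup A) (x := u)) ?mem_undup //.
  by rewrite H nth_index ?mem_undup.
Qed.

Lemma joined_open (G : zmodType) (E : seq (G * G)) (c : {ffun 'I_(size E) -> bool}) x u v :
  joined c x u -> open_rel c u v -> joined c x v.
Proof.
move=> [s [ps sl]] uv; exists (rcons s v); rewrite rcons_path ps sl uv last_rcons.
by [].
Qed.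

(* The walks list oriented edges, so [n] distinct entries give only [n / 2] closed
   edges: this is why [kap] enters squared. *)
Lemma perc_prob_walks (R : realType) (G : zmodType) (S : seq G) (r : nat)
    (l : nat -> nat) x w (p kap : R) :
  let B n := sumset (hat S) n in
  x \in B r -> all (mem (hat S)) w -> geodesic G S w -> (size w <= 2 * r)%N ->
  (forall i, (l i <= i)%N) ->
  (forall i, (i < size w)%N -> (0 < l i)%N -> exists T,
    [/\ (l i * (2 * T).+1 < size (B T))%N, (T + 4 * l i < i)%N
      & (i + (T + 4 * l i) < size w)%N]) ->
  0 <= p <= 1 -> 0 <= kap <= 1 -> 1 - p <= kap ^+ 2 ->
  1 - \sum_(i < size w) ((size (hat S) ^ 3) ^ (2 * l i))%:R * kap ^+ (l i).+1
   <= perc_prob (edges_in S (B (12 * r)%N)) p x (x + \sum_(a <- w) a).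
Proof.
move=> B xr wS geo wr li large p01 /andP[k0 k1] pk.
set E := edges_in S _.
(* All candidates for a neighbour, whatever the cluster: the list in the union bound must not depend
   on the configuration. *)
pose nb (f : G * G) := [seq (f.1 + d, s) | d <- B 2%N, s <- hat S].
pose e i := (x + \sum_(a <- take i w) a, nth 0 w i).
pose good i s := (l i < size (undup (e i :: s)))%N &&
  `[< {in e i :: s, forall f, exists j, matches G E f j} >].
pose L := [seq edge_set G E (e i :: s) | i <- iota 0 (size w),
   s <- [seq s <- walks _ nb (e i) (2 * l i) | good i s]].
have nbs f : (size (nb f) <= size (hat S) ^ 3)%N.
  by rewrite size_allpairs expnSr leq_mul2r size_sumset orbT.
apply: le_trans (@perc_prob_union R G E p x _ L p01 _).
  rewrite lerB // /L big_allpairs_dep /= -(big_mkord xpredT (fun i =>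
    ((size (hat S) ^ 3) ^ (2 * l i))%:R * kap ^+ (l i).+1)) /index_iota subn0.
  apply: ler_sum => i _.
  apply: (@le_trans _ _ (\sum_(s <- [seq s <- walks _ nb (e i) (2 * l i) | good i s])
       kap ^+ (l i).+1)).
    rewrite !big_filter; apply: ler_sum => s /andP[ls /asboolP sE].
    apply: (@le_trans _ _ ((kap ^+ 2) ^+ #|edge_set G E (e i :: s)|)).
      by apply: lerXn2r; rewrite ?nnegrE ?exprn_ge0 // subr_ge0; case/andP: p01.
    rewrite -exprM; apply: ler_wiXn2l => //.
    exact: leq_trans ls (size_edge_set _ _ _ sE).
  rewrite big_const_seq count_predT iter_addr_0 -[leLHS]mulr_natl.
  apply: ler_wpM2r; first exact: exprn_ge0.
  rewrite ler_nat size_filter; apply: leq_trans (count_size _ _) _.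
  exact: size_walks.
move=> c njoin; pose K v := `[< joined c x v >].
have Kx : K x by apply/asboolP; exists [::].
have Ky : ~~ K (x + \sum_(a <- w) a) by apply/asboolP.
have [i [s [iw be ps ss us]]] := boundary_walk G S K x w l wS geo Kx Ky large.
rewrite -/(e i) in be ps us; have ir := leq_trans iw wr.
have bS f : f \in e i :: s -> boundary G K f && (f.2 \in hat S).
  rewrite inE => /predU1P[->|fs]; first by rewrite be /=; apply: (allP wS); exact: mem_nth.
  have /(pathP (e i)) pth := ps; have fi : (index f s < size s)%N by rewrite index_mem.
  have := pth _ fi; rewrite nth_index // => /and5P[_ _ fS _ bf].
  by rewrite bf fS.
have matchE : {in e i :: s, forall f, exists j, matches G E f j}.
  move=> f fs; have /andP[bf fS] := bS f fs.
  (* The start [x] contributes [r], the position on [w] at most [2 * r], and the walk [4 * l i], at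
     most [8 * r]. One more letter for the other endpoint fits into [12 * r]. *)
  have f1 : f.1 \in B (11 * r)%N.
    have e1 : (e i).1 - x \in B (2 * r)%N.
      rewrite /e /= addrAC subrr add0r; apply: (@sumset_le _ _ (size (take i w))).
        by rewrite size_takel ?(ltnW iw) //; exact: ltnW.
      by apply: sumset_word; move: wS; rewrite -{1}(cat_take_drop i w) all_cat => /andP[].
    have fe : f.1 - (e i).1 \in B (8 * r)%N.
      apply: sumset_le (near_path _ _ _ _ _ _ ps fs).
      by rewrite ss; move: (li i) ir; move: (l i) => z; clear; lia.
    rewrite (_ : f.1 = f.1 - (e i).1 + ((e i).1 - x) + x); last by rewrite addrA !subrK.
    have -> : (11 * r = 8 * r + 2 * r + r)%N by clear; lia.
    by rewrite /B sumsetD // sumsetD.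
  have [r0|r0] := posnP r; first by move: ir; rewrite r0.
  have f1' : f.1 \in B (12 * r)%N by apply: sumset_le f1; rewrite leq_mul2r orbT.
  have f2' : f.1 + f.2 \in B (12 * r)%N.
    by apply: (@sumset_le _ _ (11 * r + 1)); [move: r0; clear; lia|rewrite sumsetD ?sumset_hat].
  have ff : f.1 != f.1 + f.2.
    by apply: contraTneq bf => ff; rewrite /boundary -ff addbb.
  have [|/(nthP (0, 0))[j jE Ej]|/(nthP (0, 0))[j jE Ej]] := mem_edges_in G S _ _ _ f1' f2' ff.
  - by rewrite addrC addKr.
  - by exists (Ordinal jE); rewrite /matches Ej eqxx.
  - by exists (Ordinal jE); rewrite /matches Ej eqxx orbT.
exists (edge_set G E (e i :: s)).
  apply/allpairsPdep; exists i, s; split=> //; first by rewrite mem_iota.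
  rewrite mem_filter /good us leqnn /=; apply/andP; split; first exact/asboolP.
  rewrite -ss; apply: mem_walks.
  apply: sub_path ps => f g /and5P[fg fS gS _ _].
  apply/allpairsP; exists (g.1 - f.1, g.2); split=> //=.
  by rewrite addrC subrK -surjective_pairing.
(* An open edge has both endpoints in the cluster of [x] or neither, so it cannot be a boundary
   edge. *)
move=> j; rewrite inE => /hasP[f fs fj]; apply/negP => cj.
have /andP[bf _] := bS f fs.
have opn : open_rel c f.1 (f.1 + f.2) /\ open_rel c (f.1 + f.2) f.1.
  by split; apply/existsP; exists j; rewrite cj //= orbC.
move: bf; rewrite /boundary /K; case: opn => o1 o2.
rewrite (_ : asbool (joined c x f.1) = asbool (joined c x (f.1 + f.2))) ?addbb //.
by apply: asbool_equiv_eq; split=> H; [exact: joined_open H o1|exact: joined_open H o2].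
Qed.

(** * The Peierls sum *)

Lemma exists_geodesic (G : zmodType) (S : seq G) n g : g \in sumset (hat S) n ->
  exists w, [/\ all (mem (hat S)) w, geodesic G S w, (size w <= n)%N
              & \sum_(a <- w) a = g].
Proof.
move=> gn; case: (ex_minnP (ex_intro (fun m => g \in sumset (hat S) m) n gn)) => m.
move=> /sumsetP[w wS [wm wg]] mmin; exists w; split=> //; last by rewrite wm mmin.
by move=> d; rewrite wg wm; exact: mmin.
Qed.

(** Otherwise linear growth bounds the ball of radius [r] by [(2 * (r / t) + 1) * t ^ 2], at most
    [3 * r * t] because [t <= r]. The volume hypothesis gives at least [3 * t * (r + 1)]. *)
Lemma quadratic_growth (R : realType) (G : zmodType) (S : seq G) (lam : R) (r t : nat) :
  uniq S -> S != [::] -> 0 < lam <= 1 -> (0 < t)%N ->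
  lam * r.+1%:R * ln r.+1%:R <= (size (sumset (hat S) r))%:R ->
  3 * t%:R <= lam * ln r.+1%:R ->
  (t ^ 2 <= size (sumset (hat S) ((size S ^ 2).+1 * t)))%N.
Proof.
move=> uS S0 /andP[l0 l1] t0 large tl; rewrite leqNgt; apply/negP => small.
have growth := linear_growth _ _ r t uS S0 t0 small.
have tr : (t <= r)%N.
  rewrite -(ler_nat R); have : ln r.+1%:R <= r%:R :> R.
    by rewrite -natr1 addrC; apply: le_ln1Dx; rewrite (lt_le_trans _ (ler0n _ _)) ?ltrN10.
  have : 0 <= ln r.+1%:R :> R by apply: ln_ge0; rewrite ler1n.
  have : 0 <= t%:R :> R by exact: ler0n.
  by nra.
have small3 : (size (sumset (hat S) r) <= 3 * r * t)%N.
  apply: leq_trans growth _; apply: (@leq_trans ((2 * (r %/ t)).+1 * t ^ 2)%N).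
    by rewrite leq_mul2l ltnW ?orbT.
  by have := leq_trunc_div r t; rewrite -mulnn; nia.
have : (size (sumset (hat S) r))%:R <= (3 * r * t)%:R :> R by rewrite ler_nat.
move: large tl; rewrite !natrM mulrAC -natr1.
have : 0 <= r%:R :> R by exact: ler0n.
have : 1 <= t%:R :> R by rewrite ler1n.
by nra.
Qed.

Lemma sum_half (R : realType) n : \sum_(i < n) (2^-1 : R) ^+ i <= 2.
Proof.
suff -> : \sum_(i < n) (2^-1 : R) ^+ i = 2 - 2 * 2^-1 ^+ n.
  by rewrite lerBlDr lerDl mulr_ge0 // exprn_ge0 // invr_ge0.
elim: n => [|n IH]; first by rewrite big_ord0 expr0 mulr1 subrr.
by rewrite big_ord_recr /= IH exprS; field.
Qed.

(** The power at a minimum is at most the sum of the three powers. The last two give geometric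
    series, because [eta <= 2^-Q] compensates the division by [Q] up to a factor [2 ^ Q]. *)
Lemma sum_min_exp (R : realType) (eta : R) (Q m n : nat) :
  (0 < Q)%N -> 0 <= eta <= 2^-1 ^+ Q ->
  \sum_(i < n) eta ^+ minn m (minn (i %/ Q) ((n - i) %/ Q)) <=
    n%:R * eta ^+ m + 4 * 2 ^+ Q.
Proof.
move=> Q0 /andP[e0 e1].
have half i : eta ^+ (i %/ Q) <= 2 ^+ Q * 2^-1 ^+ i.
  apply: (@le_trans _ _ ((2^-1 ^+ Q) ^+ (i %/ Q))).
    by apply: lerXn2r; rewrite ?nnegrE ?exprn_ge0 ?invr_ge0.
  rewrite -exprM -ler_pdivrMl ?exprn_gt0 //.
  rewrite -exprVn -exprD; apply: ler_wiXn2l.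
  - by rewrite invr_ge0.
  - by rewrite invf_le1 // ler1n.
  - by have := divn_eq i Q; have := ltn_pmod i Q0; lia.
apply: (@le_trans _ _ (\sum_(i < n) (eta ^+ m + (2 ^+ Q * 2^-1 ^+ i +
     2 ^+ Q * 2^-1 ^+ (n - i))))).
  apply: ler_sum => i _.
  have p0 j : 0 <= eta ^+ j by exact: exprn_ge0.
  apply: (@le_trans _ _ (eta ^+ m + (eta ^+ (i %/ Q) + eta ^+ ((n - i) %/ Q)))).
    have := p0 m; have := p0 (i %/ Q)%N; have := p0 ((n - i) %/ Q)%N.
    by rewrite /minn; case: ifP => _; [|case: ifP => _]; lra.
  by rewrite lerD2l lerD.
rewrite !big_split /= sumr_const card_ord -[X in X + _ <= _]mulr_natl lerD2l -!mulr_sumr -mulrDr mulrC.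
apply: ler_wpM2r; first exact: exprn_ge0.
have -> : 4 = 2 + 2 :> R by rewrite -natrD.
apply: lerD; first exact: sum_half.
(* Reversal turns the exponent [n - i] into [i + 1]. *)
rewrite (reindex_inj rev_ord_inj) /=.
apply: le_trans (sum_half R n); apply: ler_sum => i _.
apply: ler_wiXn2l; rewrite ?invr_ge0 // ?invf_le1 ?ler1n //.
by have := ltn_ord i; lia.
Qed.

Theorem theorem3p4 (R : realType) (k : nat) : (1 <= k)%N ->
  exists C : nat, forall lam eps : R, 0 < lam <= 1 -> 0 < eps <= 1 ->
  exists p0 : R, p0 < 1 /\
  forall (G : zmodType) (S : k.-tuple G),
    uniq S ->
    (forall g : G, exists m : nat, g \in sumset (hat S) m) ->
    forall r : nat, (1 <= r)%N ->
    lam * (r.+1)%:R * ln ((r.+1)%:R) <= (size (sumset (hat S) r))%:R ->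
    forall p : R, p0 <= p -> p <= 1 ->
    forall x y : G, x \in sumset (hat S) r -> y \in sumset (hat S) r ->
      1 - eps <= perc_prob (edges_in S (sumset (hat S) (C * r))) p x y.
Proof.
move=> k0; exists 12 => lam eps /andP[lam0 lam1] /andP[eps0 eps1].
(* With [t = Q0 * l] and [T = (k ^ 2 + 1) * t], the choice of [Q0] gives [l * (2 * T + 1) < t ^ 2],
   and that of [Q] gives [T + 4 * l < Q * l]. The number [b] bounds the degree of the walks, and [c]
   makes [l <= c * ln (r + 1)] imply [3 * t <= lam * ln (r + 1)]. *)
pose Q0 := (2 * (k ^ 2).+1 + 2)%N.
pose Q := ((k ^ 2).+1 * Q0 + 5)%N.
pose b := ((2 * k).+1 ^ 3)%N.
pose c : R := lam / (3 * Q0%:R).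
have Q0_gt0 : 0 < Q0%:R :> R by rewrite ltr0n /Q0; lia.
have c0 : 0 < c by rewrite divr_gt0 // mulr_gt0.
pose rho := expR (- c^-1).
have rho0 : 0 < rho by exact: expR_gt0.
have rho1 : rho <= 1 by rewrite -expR0 ler_expR oppr_le0 invr_ge0 ltW.
have b0 : 1 <= (b ^ 2)%:R :> R by rewrite ler1n expn_gt0 /b expn_gt0.
have bV : 0 < ((b ^ 2)%:R : R)^-1 <= 1.
  by rewrite invr_gt0 invf_le1 (lt_le_trans ltr01 b0).
pose h : R := 2^-1 ^+ Q.
have h0 : 0 < h by rewrite exprn_gt0 // invr_gt0.
have h1 : h <= 1 by rewrite exprn_ile1 ?invr_ge0 // invf_le1 // ler1n.
(* Here [rho] beats the number of positions, [h] the factor [2 ^ Q] of the geometric series, and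
   [eps / 8] leaves room for both error terms. Dividing by [b ^ 2] in [kap] absorbs the number of
   walks of [2 * l] steps. *)
pose eta := eps * rho * h / 8.
pose kap := eta / (b ^ 2)%:R.
have eta0 : 0 < eta by rewrite divr_gt0 ?mulr_gt0.
have er1 : eps * rho <= 1 by rewrite mulr_ile1 // ltW.
have er0 : 0 < eps * rho by rewrite mulr_gt0.
have etah : eta <= h.
  by rewrite /eta; move: (eps * rho) er1 er0 h0 => z; clear; nra.
have kap0 : 0 < kap by rewrite /kap mulr_gt0 //; case/andP: bV.
have kapeta : kap <= eta by rewrite /kap ler_piMr ?(ltW eta0) //; case/andP: bV.
have kap1 : kap <= 1 by rewrite (le_trans kapeta) // (le_trans etah).
exists (1 - kap ^+ 2); split; first by rewrite ltrBlDr ltrDl exprn_gt0.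
move=> G S uS _ r r0 large p pk p1 x y xr yr.
have yx : y - x \in sumset (hat S) (2 * r).
  by rewrite mul2n -addnn sumsetD ?sumsetN.
have [w [wS geo wr wyx]] := exists_geodesic _ _ _ _ yx.
have -> : y = x + \sum_(a <- w) a by rewrite wyx addrC subrK.
have lnr : 0 <= ln r.+1%:R :> R by apply: ln_ge0; rewrite ler1n.
pose m := Num.truncn (c * ln r.+1%:R).
have /andP[mle mgt] : m%:R <= c * ln r.+1%:R < m.+1%:R.
  by apply: truncn_itv; rewrite mulr_ge0 // ltW.
pose l i := minn m (minn (i %/ Q) ((size w - i) %/ Q)).
have p01 : 0 <= p <= 1.
  by rewrite p1 andbT (le_trans _ pk) // subr_ge0 exprn_ile1 // ltW.
have sizeS : size S = k by rewrite size_tuple.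
have szhat : size (hat S) = (2 * k).+1.
  by rewrite /hat size_cat /= size_map sizeS addnS addnn mul2n.
apply: le_trans (perc_prob_walks R G S r l x w p kap xr wS geo wr _ _ p01 _ _).
- rewrite lerB // szhat -/b.
  have -> : \sum_(i < size w) (b ^ (2 * l i))%:R * kap ^+ (l i).+1 =
      kap * \sum_(i < size w) eta ^+ l i.
    rewrite mulr_sumr; apply: eq_bigr => i _.
    rewrite exprS expnM natrX mulrCA -exprMn; congr (_ * _ ^+ _).
    by rewrite /kap mulrC divfK // gt_eqF // (lt_le_trans ltr01).
  have Q_gt0 : (0 < Q)%N by rewrite /Q addn_gt0 orbT.
  have e01 : 0 <= eta <= 2^-1 ^+ Q by rewrite ltW.
  apply: le_trans (ler_wpM2l (ltW kap0) (sum_min_exp _ _ _ m (size w) Q_gt0 e01)) _.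
  (* The prefactor [kap <= eta] raises the exponent to [m + 1 > c * ln (r + 1)]. Then
     [rho ^ (m + 1)] is at most [1 / (r + 1)], which cancels the at most [2 * (r + 1)] positions. *)
  have etam : (size w)%:R * eta ^+ m.+1 <= 2 * (eps / 8).
    pose eta1 := eps * h / 8.
    have eta1_0 : 0 <= eta1 by rewrite divr_ge0 ?mulr_ge0 // ltW.
    have eta1_1 : eta1 <= eps / 8 by rewrite /eta1; move: eps0 h1 h0; clear; nra.
    have -> : eta ^+ m.+1 = eta1 ^+ m.+1 * rho ^+ m.+1.
      by rewrite -exprMn; congr (_ ^+ _); rewrite /eta /eta1; ring.
    have rhom : rho ^+ m.+1 <= r.+1%:R^-1.
      rewrite /rho -expRM_natr -[leRHS](@lnK R) ?posrE ?invr_gt0 ?ltr0n //.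
      rewrite ler_expR lnV ?posrE ?ltr0n // mulNr lerN2.
      by rewrite -ler_pdivrMl ?invr_gt0 // invrK ltW.
    have eta1m : eta1 ^+ m.+1 <= eps / 8.
      apply: (le_trans _ eta1_1); rewrite -[leRHS]expr1; apply: ler_wiXn2l => //.
      by rewrite (le_trans eta1_1) //; move: eps1; clear; lra.
    have wr' : (size w)%:R <= 2 * r.+1%:R :> R.
      by rewrite -natrM ler_nat (leq_trans wr) // leq_mul2l leqnSn orbT.
    have r1 : 0 < r.+1%:R :> R by rewrite ltr0n.
    apply: (@le_trans _ _ ((2 * r.+1%:R) * ((eps / 8) * r.+1%:R^-1))).
      apply: ler_pM => //; first by rewrite mulr_ge0 // exprn_ge0 // ltW.
      by apply: ler_pM; rewrite // exprn_ge0 // ltW.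
    by rewrite mulrACA mulfV ?lt0r_neq0 // mulr1.
  rewrite mulrDr.
  have t1 : kap * ((size w)%:R * eta ^+ m) <= 2 * (eps / 8).
    apply: le_trans etam; rewrite mulrCA exprS.
    apply: ler_wpM2l => //; apply: ler_wpM2r => //; exact/exprn_ge0/ltW.
  have t2 : kap * (4 * 2 ^+ Q) <= eps / 2.
    apply: (@le_trans _ _ (eta * (4 * 2 ^+ Q))).
      by apply: ler_wpM2r => //; rewrite mulr_ge0 // exprn_ge0.
    have hQ : h * 2 ^+ Q = 1 by rewrite /h -exprMn mulVf ?expr1n // pnatr_eq0.
    have -> : eta * (4 * 2 ^+ Q) = eps * rho / 2 * (h * 2 ^+ Q) by rewrite /eta; field.
    by rewrite hQ mulr1; move: eps0 rho1; clear; nra.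
  by move: t1 t2 eps0; clear; lra.
- move=> i; rewrite /l; apply: leq_trans (geq_minr _ _) _.
  by apply: leq_trans (geq_minl _ _) _; exact: leq_div.
- move=> i iw li0; pose t := (Q0 * l i)%N; exists ((k ^ 2).+1 * t)%N.
  have lQi : (Q * l i <= i)%N.
    apply: leq_trans (leq_trunc_div i Q); rewrite mulnC leq_mul2r.
    by rewrite /l !geq_min leqnn !orbT.
  have lQn : (Q * l i <= size w - i)%N.
    apply: leq_trans (leq_trunc_div (size w - i) Q); rewrite mulnC leq_mul2r.
    by rewrite /l !geq_min leqnn !orbT.
  have t0 : (0 < t)%N by rewrite muln_gt0 li0 andbT /Q0 addn_gt0 orbT.
  have tl : 3 * t%:R <= lam * ln r.+1%:R.
    have lm : (l i)%:R <= c * ln r.+1%:R by apply: le_trans mle; rewrite ler_nat geq_minl.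
    have -> : lam = 3 * Q0%:R * c by rewrite /c mulrC divfK // mulf_neq0 ?pnatr_eq0 // lt0r_neq0.
    by rewrite /t natrM mulrA -[leRHS]mulrA; apply: ler_wpM2l => //; rewrite mulr_ge0.
  have S0 : tval S != [::] by rewrite -size_eq0 sizeS -lt0n.
  have lam01 : 0 < lam <= 1 by rewrite lam0.
  have := quadratic_growth R G S lam r t uS S0 lam01 t0 large tl.
  rewrite sizeS => quad; split.
  + apply: leq_trans quad; rewrite (_ : t ^ 2 = Q0 * l i * t)%N; last by rewrite -mulnn.
    rewrite /Q0.
    (* The summand 2 in [Q0] yields [2 * l * t], which exceeds the [l] still needed. *)
    rewrite (_ : _ * l i * t = l i * (2 * ((k ^ 2).+1 * t)) + 2 * (l i * t))%N; last by ring.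
    rewrite mulnS; have := leq_pmulr (l i) t0; move: (l i * t)%N (l i * (2 * _))%N li0.
    by move: (l i); clear; lia.
  + by move: lQi li0; rewrite /Q /t; move: (l i) => z; clear; nia.
  + by move: lQn li0 iw; rewrite /Q /t; move: (l i) (size w) => z n; clear; nia.
- by rewrite ltW.
- by move: pk; clear; lra.
Qed.
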